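(* Let $n\ge 6$ and let $L$ be a lattice of dimension $n$, of maximal index $2$ and of length $\ell=n$. Then $L$ has fewer than $\frac{n(n+1)}{2}$ pairs $\pm x$ of minimal vectors; in particular $L$ is not perfect.
   Context: A lattice $L$ of dimension $n$ is a full-rank lattice in an $n$-dimensional Euclidean space $E$. Its minimal vectors are its nonzero vectors of smallest norm; $S(L)$ denotes the set of minimal vectors. $L$ is well rounded if $S(L)$ spans $E$. For a well rounded lattice $L$, the maximal index of $L$ is $\max_M [L:M]$, where $M$ runs through the sublattices of $L$ spanned by $n$ linearly independent minimal vectors of $L$. For a lattice $L$ of maximal index $2$, the length $\ell\le n$ of $L$ is the minimal cardinality $|X|$ of a non-empty set $X$ of linearly independent minimal vectors of $L$ such that $\sum_{x\in X}x\equiv 0 \bmod 2L$. $L$ is perfect if the orthogonal projections $p_x$ of $E$ onto the lines $\mathbb{R}x$, $x\in S(L)$, span the $\frac{n(n+1)}{2}$-dimensional space of symmetric endomorphisms of $E$. *)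

(* Defs.v *)
From mathcomp Require Import all_boot all_order all_algebra.
From mathcomp Require Import boolp classical_sets functions cardinality reals.

Set Implicit Arguments.
Unset Strict Implicit.
Unset Printing Implicit Defensive.

Import GRing.Theory Num.Theory.
Local Open Scope classical_set_scope.
Local Open Scope card_scope.
Local Open Scope ring_scope.

Section LinearSpan.
Variables (K : fieldType) (V : vectType K).

Definition lin_span (A : set V) : set V :=
  [set v | exists s : seq V, (forall x, x \in s -> A x) /\ v \in <<s>>%VS].

End LinearSpan.

Section Lattices.
Variables (R : realType) (n : nat).
(* E is R^n with its standard inner product. *)
Local Notation E := 'rV[R]_n.
Implicit Types (L M : set E) (x y : E).

Definition dot x y : R := (x *m y^T) 0 0.

Definition int_span (b : n.-tuple E) : set E := [set v | inIntSpan b v].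

Definition is_lattice L := exists b : n.-tuple E, free b /\ L = int_span b.

Definition min_vectors L : set E :=
  [set x | [/\ L x, x != 0 & forall y, L y -> y != 0 -> dot x x <= dot y y]].

Definition well_rounded L := lin_span (min_vectors L) = setT.

Definition min_sublattice L M := exists b : n.-tuple E,
  [/\ free b, forall x, x \in b -> min_vectors L x & M = int_span b].

Definition cosets L M : set (set E) := [set [set x + y | y in M] | x in L].

(* [L : M] = k; these indices are always finite for the sublattices below. *)
Definition has_index L M (k : nat) := cosets L M #= `I_k.

Definition has_maximal_index L (m : nat) :=
  (exists M, min_sublattice L M /\ has_index L M m) /\
  (forall M k, min_sublattice L M -> has_index L M k -> (k <= m)%N).

(* A finite set X of linearly independent vectors is encoded as a sequence;
   [free X] excludes repetitions, so that [size X] is the cardinality of X. *)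
Definition even_min_set L (X : seq E) :=
  [/\ X != [::], free X, forall x, x \in X -> min_vectors L x &
      [set x *+ 2 | x in L] (\sum_(x <- X) x)].

Definition has_length L (l : nat) :=
  (exists X, even_min_set L X /\ size X = l) /\
  (forall X, even_min_set L X -> (l <= size X)%N).

Definition min_pairs L : set (set E) := [set [set x; - x] | x in min_vectors L].

(* Endomorphisms of E act on row vectors by right multiplication, so that
   v *m line_proj x = (dot v x / dot x x) *: x. *)
Definition line_proj x : 'M[R]_n := (dot x x)^-1 *: (x^T *m x).

Definition perfect L :=
  lin_span [set line_proj x | x in min_vectors L] = [set A : 'M[R]_n | A^T = A].

End Lattices.

(* Main.v *)
(* Let e_1, ..., e_n be independent minimal vectors with (e_1 + ... + e_n)/2 in
   L. Replacing some of the e_i by other minimal vectors yields frames of index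
   at most 2, and the length hypothesis says that in a frame of index 2 the
   half-sum of all n vectors lies in L. Hence every minimal vector is some
   +-e_i or a half-sum (+-e_1 +- ... +- e_n)/2, and the sign vectors of the
   latter form a family avoiding two patterns: a 5 x 5 block J - 2I (a frame of
   index 3), and a 4 x 4 Hadamard block with one of its columns repeated (a
   frame of index 2 whose half-sum relation misses a vector). Both conditions
   survive the deletion of a column.
   Join two sign vectors of a family F with n columns when they differ in one
   column. The first pattern bounds the degrees by 4, and the second excludes
   that all of them equal 4. Deleting column c from F loses half the number of
   edge ends in direction c; summing over c gives 2n|F| < 2n f(n-1) + 4|F|, where
   f(n-1) bounds the families with n - 1 columns, so the bound f(n) = n(n-1)
   propagates and becomes strict. The induction starts at n = 5: the even sets
   missing from F form a covering array of strength 2 with five columns, so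
   there are at least 6 of them. *)
From mathcomp Require Import all_boot all_order all_algebra.
From mathcomp Require Import zify ring lra.

Set Implicit Arguments.
Unset Strict Implicit.
Unset Printing Implicit Defensive.

(** * Sign patterns: the graph of one-column changes *)

Section SignPatterns.
Variable T : finType.
Implicit Types (c d i j k l m : T) (A B C K : {set T}) (F : {set {set T}}).

Definition flip c A := [set z | (z \in A) (+) (z == c)].

(* Members of [F] stand for sign vectors indexed by [K]; [B] absorbs the signs
   of the columns, and closure under complement those of the rows. The columns
   [k], [l], [m], [j] form a Hadamard matrix, and [i] repeats [j]. *)
Record good K F : Prop := Good {
  good_sub : forall A, A \in F -> A \subset K;
  good_compl : forall A, A \in F -> K :\: A \in F;
  no_hadamard : forall (A : bool -> bool -> {set T}) B k l m i j,
    uniq [:: k; l; m; i; j] -> {subset [:: k; l; m; i; j] <= K} ->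
    (forall a b, A a b \in F) ->
    (forall a b, [/\ (k \in A a b) = (k \in B) (+) a,
                     (l \in A a b) = (l \in B) (+) b,
                     (m \in A a b) = (m \in B) (+) (a (+) b),
                     (i \in A a b) = (i \in B) & (j \in A a b) = (j \in B)]) ->
    False;
  no_simplex : forall (A : T -> {set T}) B C,
    C \subset K -> #|C| = 5 -> (forall c, c \in C -> A c \in F) ->
    (forall c d, c \in C -> d \in C -> (d \in A c) = (d \in B) (+) (d == c)) ->
    False }.

Lemma in_flip c A z : (z \in flip c A) = (z \in A) (+) (z == c).
Proof. by rewrite inE. Qed.

Lemma flipK c : involutive (flip c).
Proof. by move=> A; apply/setP => z; rewrite !in_flip -addbA addbb addbF. Qed.

Definition del c F := [set A :\ c | A in F].

(** Each forbidden pattern constrains only the columns it names, so a pattern in the deletion lifts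
    to [F] once every member is replaced by a preimage. *)
Lemma good_del K F c : c \in K -> good K F -> good (K :\ c) (del c F).
Proof.
move=> cK [sub compl had simp].
(* [sec] chooses a preimage under deletion; the default [set0] is never reached on [del c F]. *)
pose sec y := odflt set0 [pick A in F | A :\ c == y].
have secP y : y \in del c F -> sec y \in F /\ sec y :\ c = y.
  move=> /imsetP [A AF ->]; rewrite /sec; case: pickP => [A' /andP[A'F /eqP //]|].
  by move=> /(_ A); rewrite AF eqxx.
have secE y z : y \in del c F -> z \in K :\ c -> (z \in sec y) = (z \in y).
  move=> /secP[_ yE] /setD1P[zc _].
  by rewrite -[in RHS]yE !inE zc.
split.
- by move=> _ /imsetP[A AF ->]; rewrite setSD // sub.
- move=> _ /imsetP[A AF ->]; apply/imsetP; exists (K :\: A); first exact: compl.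
  by apply/setP => z; rewrite !inE; case: (z == c).
- move=> A B k l m i j un sK AF H.
  apply: (had (fun a b => sec (A a b)) B k l m i j un).
  + by move=> z /sK /setD1P[].
  + by move=> a b; case: (secP _ (AF a b)).
  + move=> a b; have := H a b.
    by rewrite !(@secE (A a b)) // sK // !inE eqxx ?orbT.
- move=> A B C CK C5 AF H.
  have CK' := subsetP CK.
  apply: (simp (fun c => sec (A c)) B C _ C5).
  + by apply/subsetP => z /CK' /setD1P[].
  + by move=> d /AF /secP[].
  + by move=> d z dC zC; rewrite secE ?H ?AF ?CK'.
Qed.

(** These are the ends of the edges in direction [c], so each edge counts twice. *)
Definition edges F c := [set A in F | flip c A \in F].

Definition dirs K F A := [set c in K | flip c A \in F].

(** Deletion identifies two members of [F] exactly when an edge in direction [c] joins them, so it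
    loses half the number of edge ends. *)
Lemma card_del K F c : 2 * #|F| <= 2 * #|del c F| + #|edges F c|.
Proof.
pose F1 := [set A in F | c \in A]; pose F0 := [set A in F | c \notin A].
pose F1' := [set A :\ c | A in F1].
have cF : #|F| = #|F1| + #|F0|.
  rewrite -(cardsID [set A : {set T} | c \in A] F); congr (_ + _); apply: eq_card => A.
    by rewrite !inE.
  by rewrite !inE andbC.
have cF1 : #|F1'| = #|F1|.
  apply: card_in_imset => A A'; rewrite !inE => /andP[_ cA] /andP[_ cA'] eq.
  by rewrite -(setD1K cA) eq setD1K.
have delE : del c F = F1' :|: F0.
  apply/setP => A; apply/imsetP/setUP => [[A' A'F ->]|[/imsetP[A' + ->]|]].
  - case: (boolP (c \in A')) => cA'; [left|right].
      by apply/imsetP; exists A'; rewrite // inE A'F.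
    by rewrite inE !inE eqxx /= andbT; rewrite (setDidPl _) // disjoint_sym disjoints1.
  - by rewrite inE => /andP[A'F _]; exists A'.
  - rewrite inE => /andP[AF cA]; exists A => //.
    by rewrite (setDidPl _) // disjoint_sym disjoints1.
(* [W] collects the sets with two preimages; [W] and [W1] hold the two ends of the corresponding
   edges. *)
pose W := F1' :&: F0; pose W1 := [set c |: A | A in W].
have cW1 : #|W1| = #|W|.
  apply: card_in_imset => A A'; rewrite !inE => /and3P[_ _ cA] /and3P[_ _ cA'] eq.
  by rewrite -(setU1K cA) eq setU1K.
have flipW A : A \in W -> [/\ A \in F, c |: A \in F, flip c A = c |: A & c \notin A].
  move=> /setIP[/imsetP[A']]; rewrite !inE => /andP[A'F cA'] -> /andP[-> ->].
  rewrite setD1K //; split=> //; apply/setP => z; rewrite !inE.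
  by case: eqP => [->|]; rewrite ?cA' // addbF.
have Wsub : W :|: W1 \subset edges F c.
  apply/subsetP => A /setUP[/flipW[AF A1F fl _]|/imsetP[A' /flipW[AF A1F fl _] ->]].
    by rewrite inE AF fl.
  by rewrite inE A1F -fl flipK.
have disj : [disjoint W & W1].
  rewrite -setI_eq0; apply/eqP/setP => A; rewrite [in RHS]inE; apply/negP => /setIP[].
  by move=> /flipW[_ _ _ +] /imsetP[A' _ eqA]; rewrite eqA !inE eqxx.
have := subset_leq_card Wsub; have := leq_card_setU W W1; rewrite disj => /leqifP /eqP ->.
have := cardsUI F1' F0; rewrite -/W cW1 delE cF cF1 => <-; by rewrite mulnDr leq_add2l mul2n -addnn.
Qed.

Lemma sum_edges K F : \sum_(c in K) #|edges F c| = \sum_(A in F) #|dirs K F A|.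
Proof.
under eq_bigr => c _ do rewrite -sum1_card.
under [RHS]eq_bigr => A _ do rewrite -sum1_card.
rewrite (exchange_big_dep (mem F)) /=; last by move=> c A _; rewrite inE => /andP[].
by apply: eq_bigr => A AF; apply: eq_bigl => c; rewrite !inE AF.
Qed.

(** Neighbours of [A] in five directions would form the simplex pattern, with [A] itself as the
    column signs. *)
Lemma card_dirs K F A : good K F -> #|dirs K F A| <= 4.
Proof.
move=> gF; rewrite leqNgt; apply/negP => c5.
pose C := [set c in take 5 (enum (dirs K F A))].
have CD : {subset C <= dirs K F A} by move=> c; rewrite inE => /mem_take; rewrite mem_enum.
apply: (@no_simplex _ _ gF (fun c => flip c A) A C).
- by apply/subsetP => c /CD; rewrite inE => /andP[].
- rewrite cardsE (card_uniqP _) ?take_uniq ?enum_uniq // size_takel //.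
  by rewrite -cardE.
- by move=> c /CD; rewrite inE => /andP[].
- by move=> c d _ _; rewrite in_flip.
Qed.


Lemma card_geq_seq (q : nat) A : q <= #|A| -> exists s, [/\ uniq s, size s = q & {subset s <= A}].
Proof.
move=> qA; exists (take q (enum A)); split; first by rewrite take_uniq ?enum_uniq.
  by rewrite size_takel // -cardE.
by move=> z /mem_take; rewrite mem_enum.
Qed.

(* The neighbours of [A] in four directions form a Hadamard pattern; at the
   first of them, a fifth direction would repeat one of its columns. *)
Lemma dirs_flip K F A c : good K F -> #|dirs K F A| = 4 -> c \in dirs K F A ->
  dirs K F (flip c A) \subset dirs K F A.
Proof.
move=> gF D4 cD; apply/subsetP => j jD; apply: contraT => jnD.
have /card_geq_seq : 3 <= #|dirs K F A :\ c| by rewrite (cardsD1 c) cD in D4; lia.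
case=> -[|k [|l [|m [|? ?]]]] [] // unq _ sD.
have D1 z : z \in [:: k; l; m] -> [/\ z != c, z != j, z \in K & flip z A \in F].
  move=> /sD /setD1P[-> zD]; move: (zD); rewrite inE => /andP[-> ->]; split=> //.
  by apply: contraNneq jnD => <-.
have [|kc kj kK kF] := D1 k; first by rewrite !inE eqxx.
have [|lc lj lK lF] := D1 l; first by rewrite !inE eqxx orbT.
have [|mc mj mK mF] := D1 m; first by rewrite !inE eqxx !orbT.
have cj : c != j by apply: contraNneq jnD => <-.
move: cD jD; rewrite !inE => /andP[cK cF] /andP[jK jcF].
(* The last row is the complement of the neighbour of [flip c A] in direction [j]: it opposes [A] on
   [k], [l], [m] and agrees with [A] on [c] and [j], which thus become equal columns. *)
pose r a b := if a then flip (if b then m else l) A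
              else if b then flip k A else K :\: flip j (flip c A).
exfalso; apply: (@no_hadamard _ _ gF r (~: flip j (flip c A)) k l m c j).
- move: unq; rewrite /= !inE !negb_or => /andP[/andP[-> ->] /andP[-> _]].
  by rewrite kc kj lc lj mc mj cj.
- by apply/allP; rewrite /= kK lK mK cK jK.
- by move=> [] [] //=; apply: good_compl gF _ _.
- move: unq; rewrite /= !inE !negb_or => /andP[/andP[kl km] /andP[lm _]].
  have sy (x y : T) : x != y -> (x == y) = false /\ (y == x) = false.
    by move=> /negbTE xy; rewrite [y == x]eq_sym xy.
  have [[kl1 kl2] [km1 km2] [lm1 lm2]] := And3 (sy _ _ kl) (sy _ _ km) (sy _ _ lm).
  have [[kc1 kc2] [lc1 lc2] [mc1 mc2]] := And3 (sy _ _ kc) (sy _ _ lc) (sy _ _ mc).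
  have [[kj1 kj2] [lj1 lj2] [mj1 mj2]] := And3 (sy _ _ kj) (sy _ _ lj) (sy _ _ mj).
  have [cj1 cj2] := sy _ _ cj.
  pose E := (kl1, kl2, km1, km2, lm1, lm2, kc1, kc2, lc1, lc2, mc1, mc2,
            (kj1, kj2, lj1, lj2, mj1, mj2, cj1, cj2)).
  pose E' := (in_flip, in_setC, in_setD, E, eqxx, kK, lK, mK, cK, jK,
              addbF, addbT, andbT, negbK).
  by move=> [] []; split; rewrite /r !E'.
Qed.

(** If all degrees were 4, the neighbours of [A] would have the same four directions as [A], so two
    flips in these directions would stay in [F]. Then [A] and its double flips within [k], [l], [m]
    form the Hadamard pattern, constant on the fourth direction [i] and on a column [j] that is no
    direction. *)
Lemma exists_small_dirs K F : good K F -> 4 < #|K| -> F != set0 ->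
  exists2 A, A \in F & #|dirs K F A| < 4.
Proof.
move=> gF K5 /set0Pn[A AF].
case: (boolP [exists B in F, #|dirs K F B| < 4]) => [/exists_inP //|].
rewrite negb_exists_in => /forall_inP D4; exfalso; have {}D4 B : B \in F -> #|dirs K F B| = 4.
  by move=> BF; apply/eqP; rewrite eqn_leq card_dirs // leqNgt D4.
have Dflip c : c \in dirs K F A -> dirs K F (flip c A) = dirs K F A.
  move=> cD; apply/eqP; rewrite eqEcard dirs_flip ?D4 //.
  by move: cD; rewrite inE => /andP[].
have flip2 c d : c \in dirs K F A -> d \in dirs K F A -> flip d (flip c A) \in F.
  by move=> cD; rewrite -{1}(Dflip c) // inE => /andP[].
have /card_geq_seq : 4 <= #|dirs K F A| by rewrite D4.
case=> -[|k [|l [|m [|i [|? ?]]]]] [] // unq _ sD.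
have /subsetPn[j jK jD] : ~~ (K \subset dirs K F A).
  by apply: contraTN K5 => /subset_leq_card; rewrite D4 // -leqNgt.
have DK z : z \in dirs K F A -> z \in K by rewrite inE => /andP[].
have /allP/and5P[kD lD mD iD _] := sD.
have sy (x y : T) : x != y -> (x == y) = false /\ (y == x) = false.
  by move=> /negbTE xy; rewrite [y == x]eq_sym xy.
have jN z : z \in dirs K F A -> (j == z) = false.
  by move=> zD; apply: contraNF jD => /eqP->.
pose r a b := if a then flip (if b then l else m) (flip k A)
              else if b then flip m (flip l A) else A.
apply: (@no_hadamard _ _ gF r A k l m i j).
- rewrite -[_ :: _]/(rcons [:: k; l; m; i] j) rcons_uniq unq andbT.
  by apply: contra jD => /sD.
- by apply/allP; rewrite /= jK (DK _ kD) (DK _ lD) (DK _ mD) (DK _ iD).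
- by move=> [] []; rewrite /r ?flip2.
move: unq; rewrite /= !inE !negb_or -!andbA => /and5P[kl km ki lm /and3P[li mi _]].
have [[kl1 kl2] [km1 km2] [lm1 lm2]] := And3 (sy _ _ kl) (sy _ _ km) (sy _ _ lm).
have [[ki1 ki2] [li1 li2] [mi1 mi2]] := And3 (sy _ _ ki) (sy _ _ li) (sy _ _ mi).
pose E := (kl1, kl2, km1, km2, lm1, lm2, ki1, ki2, li1, li2, mi1, mi2,
           jN _ kD, jN _ lD, jN _ mD, in_flip, eqxx, addbF).
by move=> [] []; split; rewrite /r ?E.
Qed.

Lemma sum_edges_lt K F : good K F -> 4 < #|K| -> F != set0 ->
  \sum_(c in K) #|edges F c| < 4 * #|F|.
Proof.
move=> gF K5 F0; have [A AF A4] := exists_small_dirs gF K5 F0.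
rewrite (sum_edges K) (bigD1 A) //= (cardsD1 A) AF mulnDr -addSn leq_add //.
rewrite mulnC -sum_nat_const [leqLHS](eq_bigl [in F :\ A]).
  by apply: leq_sum => B /setD1P[_ BF]; exact: card_dirs.
by move=> B; rewrite !inE andbC.
Qed.
End SignPatterns.

(* Five pairwise qualitatively independent two-valued columns need six rows. *)
Section CoveringArrays.

Definition qindep (c d : seq bool) :=
  all (fun p => p \in zip c d) [:: (true, true); (true, false); (false, true); (false, false)].

Fixpoint bitseqs (p : nat) : seq bitseq :=
  if p is p'.+1 then [seq b :: s | b <- [:: false; true], s <- bitseqs p'] else [:: [::]].

(** Exhaustive search for [k] pairwise independent columns. No column is independent of itself, so
    the filter also drops [c]. *)
Fixpoint qclique (k : nat) (cs : seq bitseq) : bool :=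
  if k is k'.+1 then has (fun c => qclique k' [seq d <- cs | qindep c d]) cs else true.

Lemma mem_bitseqs s : s \in bitseqs (size s).
Proof.
elim: s => //= b s IH; rewrite /= cats0 mem_cat.
by case: b; rewrite (map_f _ IH) ?orbT.
Qed.

(** Completeness of the search, by which its negative outcome rules out actual cliques. *)
Lemma qclique_complete cs s : uniq s -> {subset s <= cs} ->
  {in s &, forall c d, c != d -> qindep c d} -> qclique (size s) cs.
Proof.
elim: s cs => //= c s IH cs /andP[cs_ us] sub qi; apply/hasP; exists c.
  by apply: sub; rewrite mem_head.
apply: IH us _ _.
- move=> d ds; rewrite mem_filter sub ?inE ?ds ?orbT // andbT.
  apply: qi; rewrite ?inE ?eqxx ?ds ?orbT //.
  by apply: contraNneq cs_ => ->.
- by move=> d d' ds ds'; apply: qi; rewrite inE ?ds ?ds' orbT.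
Qed.

Lemma no_qclique5 : qclique 5 (bitseqs 5) = false.
Proof. by vm_compute. Qed.
End CoveringArrays.

(** * Upper bounds for pattern-free families *)

Section SignPatternBound.
Variable T : finType.
Implicit Types (c d i j k l m z : T) (A B C K U : {set T}) (F : {set {set T}}).

(** Exactly four even subsets of [K] have the prescribed values at [i] and [j]. On the other three
    columns they form the Hadamard pattern, so [F] misses one of them. *)
Lemma even_cover K F i j (s t : bool) : good K F -> #|K| = 5 -> i \in K -> j \in K -> i != j ->
  exists A, [/\ A \subset K, ~~ odd #|A|, A \notin F, (i \in A) = s & (j \in A) = t].
Proof.
move=> gF K5 iK jK ij.
have Kij : #|K :\ i :\ j| = 3.
  by have := cardsD1 i K; have := cardsD1 j (K :\ i); rewrite !inE eq_sym ij iK jK; lia.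
have [[|k [|l [|m [|? ?]]]] [] // unq _ sK] :
    exists s, [/\ uniq s, size s = 3 & {subset s <= K :\ i :\ j}].
  by apply: card_geq_seq; rewrite Kij.
have unq5 : uniq [:: k; l; m; i; j].
  rewrite -[_ :: _]/([:: k; l; m] ++ [:: i; j]) cat_uniq unq.
  apply/and3P; split=> //; last by rewrite /= inE ij.
  apply/hasPn => z zij; apply/negP => /sK; move: zij; rewrite !inE.
  by move=> /orP[] /eqP->; rewrite eqxx ?andbF.
have sub5 : {subset [:: k; l; m; i; j] <= K}.
  move=> z; rewrite -[_ :: _]/([:: k; l; m] ++ [:: i; j]) mem_cat => /orP[/sK|].
    by rewrite !inE => /and3P[].
  by rewrite !inE => /orP[] /eqP->.
have K5E : K =i [:: k; l; m; i; j].
  by apply/fsym/subset_cardP; [rewrite K5 (card_uniqP unq5)|apply/subsetP].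
pose f a b z := if z == i then s else if z == j then t
  else s (+) t (+) (if z == k then a else if z == l then b else a (+) b).
pose r a b := [set z in K | f a b z].
have fE a b : [/\ f a b i = s, f a b j = t, f a b k = s (+) t (+) a, f a b l = s (+) t (+) b
    & f a b m = s (+) t (+) (a (+) b)].
  have sy (x y : T) : x != y -> (x == y) = false /\ (y == x) = false.
    by move=> /negbTE xy; rewrite [y == x]eq_sym xy.
  move: unq5; rewrite /= !inE !negb_or -!andbA.
  move=> /and5P[kl km ki kj /and5P[lm li lj mi /andP[mj _]]].
  have [[kl1 kl2] [km1 km2] [lm1 lm2]] := And3 (sy _ _ kl) (sy _ _ km) (sy _ _ lm).
  have [[ki1 ki2] [li1 li2] [mi1 mi2]] := And3 (sy _ _ ki) (sy _ _ li) (sy _ _ mi).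
  have [[kj1 kj2] [lj1 lj2] [mj1 mj2]] := And3 (sy _ _ kj) (sy _ _ lj) (sy _ _ mj).
  have [ij1 ij2] := sy _ _ ij.
  by split; rewrite /f ?eqxx ?(kl1, kl2, km1, km2, lm1, lm2, ki1, ki2, li1, li2, mi1, mi2,
    (kj1, kj2, lj1, lj2, mj1, mj2, ij1, ij2)).
have rE a b z : z \in K -> (z \in r a b) = f a b z by move=> zK; rewrite inE zK.
have [/allP/= all_F|/allPn/=[[a b] _ abF]] :=
  boolP (all (fun p => r p.1 p.2 \in F)
    [:: (true, true); (true, false); (false, true); (false, false)]).
  exfalso; apply: (@no_hadamard _ _ _ gF r (r false false) k l m i j) => //.
    by move=> a b; apply: (all_F (a, b)); move: a b => [] [].
  move=> a b; have [fi fj fk fl fm] := fE a b; have [fi' fj' fk' fl' fm'] := fE false false.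
  have [kK lK mK _] : [/\ k \in K, l \in K, m \in K & true].
    by split=> //; apply: sub5; rewrite !inE eqxx ?orbT.
  by split; rewrite !rE // ?(fi, fj, fk, fl, fm, fi', fj', fk', fl', fm') ?addbF.
have [fi fj fk fl fm] := fE a b.
exists (r a b); split=> //; rewrite ?rE //.
  by apply/subsetP => z; rewrite inE => /andP[].
have -> : #|r a b| = count (f a b) [:: k; l; m; i; j].
  rewrite -size_filter -(card_uniqP (filter_uniq _ unq5)); apply: eq_card => z.
  by rewrite mem_filter -K5E inE andbC.
by rewrite /= fi fj fk fl fm; move: s t a b {f r fE rE fi fj fk fl fm abF} => [] [] [] [].
Qed.

(** As [#|K|] is odd, complementation exchanges even and odd sets, so half of [F] is even. At least
    six of the sixteen even sets are missing, which leaves at most ten. *)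
Lemma card_good5 K F : good K F -> #|K| = 5 -> #|F| <= 20.
Proof.
move=> gF K5.
pose ev : {set {set T}} := [set A : {set T} | ~~ odd #|A|].
have complK (A : {set T}) : A \subset K -> K :\: (K :\: A) = A.
  by move=> AK; rewrite setDDr setDv set0U (setIidPr AK).
have even_half (G : {set {set T}}) : G \subset powerset K ->
    (forall A, A \in G -> K :\: A \in G) -> #|G| = 2 * #|G :&: ev|.
  move=> GK GC; rewrite -(cardsID ev G) mul2n -addnn; congr (_ + _).
  have inj A B : A \in G -> B \in G -> K :\: A = K :\: B -> A = B.
    move=> /(subsetP GK) + /(subsetP GK) + eq; rewrite !powersetE => AK BK.
    by rewrite -(complK A AK) eq complK.
  have parity A : A \in G -> odd #|K :\: A| = ~~ odd #|A|.
    move=> /(subsetP GK); rewrite powersetE => AK.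
    by rewrite cardsD (setIidPr AK) K5 oddB // -K5 subset_leq_card.
  apply/eqP; rewrite eqn_leq; apply/andP; split.
    rewrite -(card_in_imset (f := fun A : {set T} => K :\: A) (D := G :\: ev)); last first.
      by move=> A B /setDP[AG _] /setDP[BG _]; apply: inj.
    apply: subset_leq_card; apply/subsetP => _ /imsetP[A /setDP[AG +] ->].
    by rewrite !inE GC ?parity // negbK => ->.
  rewrite -(card_in_imset (f := fun A : {set T} => K :\: A) (D := G :&: ev)); last first.
    by move=> A B /setIP[AG _] /setIP[BG _]; apply: inj.
  apply: subset_leq_card; apply/subsetP => _ /imsetP[A /setIP[AG +] ->].
  by rewrite !inE GC ?parity ?negbK ?andbT // .
have FK : F \subset powerset K by apply/subsetP => A /(good_sub gF); rewrite powersetE.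
have cF := even_half _ FK (good_compl gF).
have : #|powerset K| = 2 * #|powerset K :&: ev|.
  by apply: even_half => // A _; rewrite powersetE subsetDl.
rewrite card_powerset K5 => cP.
pose U := (powerset K :&: ev) :\: F.
have cU : #|U| + #|F :&: ev| = 16.
  rewrite addnC -(_ : #|(powerset K :&: ev) :&: F| = #|F :&: ev|) ?cardsID; first by lia.
  by rewrite setIAC (setIidPr FK).
rewrite leqNgt; apply/negP => F20; have U5 : #|U| <= 5 by lia.
(* The default [set0] pads the array to exactly five rows; extra rows cannot destroy
   independence. *)
pose col c := [seq c \in nth set0 (enum U) q | q <- iota 0 5].
have col_qindep : {in K &, forall c d, c != d -> qindep (col c) (col d)}.
  move=> c d cK dK cd; apply/allP => -[s t] _.
  have [A [AK Aev AF cA dA]] := even_cover s t gF K5 cK dK cd.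
  have AU : A \in enum U by rewrite mem_enum !inE AK Aev AF.
  rewrite /col zip_map; apply/mapP; exists (index A (enum U)).
    rewrite mem_iota /= add0n (leq_trans _ U5) // cardE index_mem //.
  by rewrite nth_index // cA dA.
have col_inj : {in K &, injective col}.
  move=> c d cK dK eq; apply/eqP; apply: contraT => cd.
  have /allP/(_ (true, false) isT) := col_qindep _ _ cK dK cd.
  by rewrite eq /col zip_map => /mapP[q _ [<-]].
suff : qclique 5 (bitseqs 5) by rewrite no_qclique5.
rewrite -{1}K5 cardE -(size_map col); apply: qclique_complete.
- rewrite map_inj_in_uniq ?enum_uniq // => c d; rewrite !mem_enum; exact: col_inj.
- move=> _ /mapP[c _ ->]; rewrite -[X in bitseqs X]/(size (iota 0 5)).
  rewrite -(size_map (fun q => c \in nth set0 (enum U) q)).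
  exact: mem_bitseqs.
- move=> _ _ /mapP[c + ->] /mapP[d + ->]; rewrite !mem_enum => cK dK cd.
  by apply: col_qindep => //; apply: contraNneq cd => ->.
Qed.

Lemma card_good K F : good K F -> 4 < #|K| ->
  #|F| <= #|K| * #|K|.-1 /\ (5 < #|K| -> #|F| < #|K| * #|K|.-1).
Proof.
move nE : #|K| => n gF n4; elim: n n4 K nE F gF => // n IH; rewrite ltnS leq_eqVlt.
move=> /predU1P[<- K K5 F gF|n4 K Kn F gF]; first by rewrite (card_good5 gF K5).
(* Every inductive step yields the strict bound; only the base case has the weak one. *)
suff lt : #|F| < n.+1 * n by split=> //; exact: ltnW.
have [->|F0] := eqVneq F set0; first by rewrite cards0; lia.
have K4 : 4 < #|K| by lia.
have sE := sum_edges_lt gF K4 F0.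
have : \sum_(c in K) 2 * #|F| <= \sum_(c in K) (2 * (n * n.-1) + #|edges F c|).
  apply: leq_sum => c cK; apply: leq_trans (card_del K F c) _.
  rewrite leq_add2r leq_mul2l /=; have Kc : #|K :\ c| = n by move: (cardsD1 c K); rewrite cK; lia.
  by have [] := IH n4 (K :\ c) Kc _ (good_del cK gF).
rewrite [leqRHS]big_split /= !sum_nat_const Kn => le.
case: n n4 sE le {IH Kn K4} => // n n4; rewrite succnK.
move: (#|F|) (\sum_(c in K) _) => f s sE le; rewrite ltnNge; apply/negP => ge.
(* With [n.+2] columns the left side is [2 * n.+2 * f]; moving the edge term [4 * f] across leaves
   the factor [2 * n]. *)
have : 2 * n * (n.+2 * n.+1) <= 2 * n * f by rewrite leq_mul2l ge orbT.
nia.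
Qed.
End SignPatternBound.

Require Import Defs.
From mathcomp Require Import boolp classical_sets functions cardinality reals.
Import Order.TTheory GRing.Theory Num.Theory.

Local Open Scope classical_set_scope.
Local Open Scope card_scope.
Local Open Scope ring_scope.

(** * Lattices, frames of minimal vectors and their index *)

Section Frames.
Variables (R : realType) (n : nat).
Implicit Types (L : set 'rV[R]_n) (F G : 'M[R]_n) (u v x : 'rV[R]_n).

(** Frames are kept as matrices, so that coordinates are [v *m invmx F]; [rows] gives the tuples
    used by the definitions. *)
Definition rows F : n.-tuple 'rV[R]_n := [tuple row i F | i < n].

Lemma rowsE F (i : 'I_n) : (rows F)`_i = row i F.
Proof. by rewrite (nth_map i) ?size_enum_ord // nth_ord_enum. Qed.

Lemma tuple_rows (b : n.-tuple 'rV[R]_n) : exists F, b = rows F.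
Proof.
exists (\matrix_(i < n) tnth b i); apply: eq_from_tnth => i.
by rewrite tnth_mktuple rowK.
Qed.

Lemma free_rows F : free (rows F) = (F \in unitmx).
Proof.
rewrite -row_free_unit; apply/freeP/idP => [fr|/row_freeP[G FG] k k0 i].
  apply: inj_row_free => v v0; apply/rowP => i; rewrite mxE.
  apply: (fr (fun i => v 0 i)); rewrite -[RHS]v0 mulmx_sum_row.
  by apply: eq_bigr => j _; rewrite rowsE.
have : (\row_j k j) *m F = 0.
  by rewrite mulmx_sum_row; under eq_bigr do rewrite -rowsE mxE.
move=> /(congr1 (mulmx^~ G)); rewrite -mulmxA FG mulmx1 mul0mx.
by move=> /rowP/(_ i); rewrite !mxE.
Qed.

Lemma int_span_rows F v : F \in unitmx ->
  int_span (rows F) v <-> forall i, (v *m invmx F) 0 i \is a Num.int.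
Proof.
move=> uF; split=> [[a ->] i|vF].
  have -> : \sum_(j < n) (rows F)`_j *~ a j = (\row_j (a j)%:~R) *m F.
    by rewrite mulmx_sum_row; apply: eq_bigr => j _; rewrite rowsE mxE scaler_int.
  by rewrite mulmxK // mxE intr_int.
exists [ffun i => Num.floor ((v *m invmx F) 0 i)].
rewrite -{1}(mulmxKV uF v) mulmx_sum_row; apply: eq_bigr => j _.
by rewrite rowsE ffunE -scaler_int; congr (_ *: _); apply/eqP; rewrite eq_sym -intrEfloor.
Qed.

Definition frame L F := F \in unitmx /\ forall i, min_vectors L (row i F).

Lemma lattice_basis L : is_lattice L ->
  exists2 G, G \in unitmx & forall v, L v <-> forall i, (v *m invmx G) 0 i \is a Num.int.
Proof.
move=> [b [fb ->]]; have [G bG] := tuple_rows b; rewrite bG free_rows in fb.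
by exists G => // v; rewrite bG int_span_rows.
Qed.

Lemma lattice0 L : is_lattice L -> L 0.
Proof. by move=> /lattice_basis[G _ LG]; apply/LG => i; rewrite mul0mx mxE. Qed.

Lemma latticeB L u v : is_lattice L -> L u -> L v -> L (u - v).
Proof.
move=> /lattice_basis[G _ LG] /LG Lu /LG Lv; apply/LG => i.
by rewrite mulmxBl mxE rpredD // mxE rpredN.
Qed.

Lemma latticeN L v : is_lattice L -> L v -> L (- v).
Proof. by move=> hL Lv; rewrite -sub0r; apply: latticeB => //; apply: lattice0. Qed.

Lemma latticeD L u v : is_lattice L -> L u -> L v -> L (u + v).
Proof. by move=> hL Lu Lv; rewrite -[v]opprK; apply: latticeB => //; apply: latticeN. Qed.

Lemma latticeZ L v (a : R) : is_lattice L -> a \is a Num.int -> L v -> L (a *: v).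
Proof.
move=> /lattice_basis[G _ LG] ia /LG Lv; apply/LG => i.
by rewrite -scalemxAl mxE rpredM.
Qed.

Lemma lattice_sum L I (r : seq I) (P : pred I) (f : I -> 'rV[R]_n) : is_lattice L ->
  (forall i, P i -> L (f i)) -> L (\sum_(i <- r | P i) f i).
Proof.
move=> hL Lf; elim/big_rec: _ => [|i x Pi Lx]; first exact: lattice0.
by apply: latticeD => //; apply: Lf.
Qed.

Lemma int_det (p : nat) (A : 'M[R]_p) : (forall i j, A i j \is a Num.int) -> \det A \is a Num.int.
Proof.
move=> iA; apply: rpred_sum => s _; rewrite rpredM ?rpredX ?rpredN1 //.
by apply: rpred_prod => i _.
Qed.

(** The maximal index bounds only indices known to be finite. With [A] the integral matrix of [F] in
    a basis of [L], the adjugate shows that [\det A] times [L] lies in the span of [F]. *)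
Lemma finite_cosets L F : is_lattice L -> F \in unitmx -> (forall i, L (row i F)) ->
  finite_set (cosets L (int_span (rows F))).
Proof.
move=> /lattice_basis[G uG LG] uF LF.
pose A := F *m invmx G.
have iA i j : A i j \is a Num.int.
  by have /LG/(_ j) := LF i; rewrite -row_mul mxE.
have uA : A \in unitmx by rewrite unitmx_mul uF unitmx_inv.
have d0 : \det A != 0 by rewrite unitmxE unitfE in uA.
have [D dD] : exists D : int, \det A = D%:~R by apply/intrP; exact: int_det.
have D0 : D != 0 by move: d0; rewrite dD intr_eq0.
have adjA i j : \adj A i j \is a Num.int.
  rewrite mxE rpredM ?rpredX ?rpredN1 //; apply: int_det => a b.
  by rewrite 2!mxE; apply: iA.
(* Representatives have basis coordinates reduced modulo [D], the determinant. *)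
pose rep (f : {ffun 'I_n -> 'I_(`|D|%N)}) := (\row_i (f i)%:R) *m G.
pose coset x := [set x + y | y in int_span (rows F)].
apply: (@sub_finite_set _ _ [set coset (rep f) | f in setT]); last first.
  exact/finite_image/finite_finset.
move=> _ [x /LG Lx <-].
have zP i : {z : int | (x *m invmx G) 0 i = z%:~R}.
  by exists (Num.floor ((x *m invmx G) 0 i)); apply/eqP; rewrite eq_sym -intrEfloor.
pose z i := sval (zP i).
have rlt i : (`|(z i %% D)%Z| < `|D|)%N.
  by rewrite -ltz_nat gez0_abs ?modz_ge0 // ltz_mod.
exists [ffun i => Ordinal (rlt i)] => //.
have xE : x - rep [ffun i => Ordinal (rlt i)] = (\row_i (z i %/ D)%Z%:~R) *m \adj A *m F.
  have zE : x = (\row_i ((z i %/ D)%Z%:~R * D%:~R + (z i %% D)%Z%:~R)) *m G.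
    rewrite -{1}(mulmxKV uG x); congr (_ *m _); apply/rowP => i; rewrite [RHS]mxE.
    by rewrite (svalP (zP i)) -intrM -intrD -divz_eq.
  have -> : F = A *m G by rewrite mulmxKV.
  rewrite mulmxA -(mulmxA _ (\adj A)) mul_adj_mx dD mul_mx_scalar.
  rewrite {1}zE /rep -mulmxBl; congr (_ *m _); apply/rowP => i; rewrite !mxE ffunE /=.
  have -> : (`|(z i %% D)%Z|%N)%:R = (z i %% D)%Z%:~R :> R.
    by rewrite -[in RHS](gez0_abs (modz_ge0 (z i) D0)).
  by rewrite addrK mulrC.
have Mx : int_span (rows F) (x - rep [ffun i => Ordinal (rlt i)]).
  apply/int_span_rows => // i; rewrite xE mulmxK // mxE.
  by apply: rpred_sum => j _; rewrite rpredM // mxE intr_int.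
have addBA (a b c : 'rV[R]_n) : a + (b + (c - a)) = c + b.
  by rewrite [b + _]addrC addrA [a + _]addrC subrK.
have MF w : int_span (rows F) w -> forall i, (w *m invmx F) 0 i \is a Num.int.
  by move/(int_span_rows _ uF).
apply/seteqP; split=> _ [y My <-].
  exists (y - (x - rep [ffun i => Ordinal (rlt i)])); last by rewrite opprB addBA.
  by apply/int_span_rows => // i; rewrite mulmxBl mxE rpredD ?MF // mxE rpredN MF.
exists (y + (x - rep [ffun i => Ordinal (rlt i)])); last exact: addBA.
by apply/int_span_rows => // i; rewrite mulmxDl mxE rpredD ?MF.
Qed.

(** There are at most two cosets, so two of those of [0], [u], [v] coincide. *)
Lemma frame_dichotomy L F u v : is_lattice L -> has_maximal_index L 2 -> frame L F ->
  L u -> L v ->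
  [\/ int_span (rows F) u, int_span (rows F) v | int_span (rows F) (u - v)].
Proof.
move=> hL [_ hmax] [uF mF] Lu Lv.
have LF i : L (row i F) by have [] := mF i.
have /finite_setP[k hk] := finite_cosets hL uF LF.
have k2 : (k <= 2)%N.
  apply: (hmax (int_span (rows F))) => //; exists (rows F); split=> //.
    by rewrite free_rows.
  by move=> _ /mapP[i _ ->].
have /card_set_bijP[f [fimg finj _]] := hk.
pose C x := [set x + y | y in int_span (rows F)].
have MB x y : C x = C y -> int_span (rows F) (x - y).
  move=> Cxy; have : C x x.
    by exists 0; rewrite ?addr0 //; apply/int_span_rows => // i; rewrite mul0mx mxE.
  by rewrite Cxy => -[w Mw <-]; rewrite addrC addKr.
have CL x : L x -> C x \in cosets L (int_span (rows F)) by move=> Lx; apply/mem_set; exists x.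
have fl x : L x -> (f (C x) < 2)%N.
  by move=> /CL/set_mem/fimg /= /leq_trans; apply.
have fi x y : L x -> L y -> f (C x) = f (C y) -> int_span (rows F) (x - y).
  by move=> Lx Ly eq; apply: MB; apply: finj => //; apply: CL.
have L0 := lattice0 hL.
have [e|ne] := eqVneq (f (C u)) (f (C 0)).
  by constructor 1; rewrite -[u]subr0; apply: fi.
have [e|ne'] := eqVneq (f (C v)) (f (C 0)).
  by constructor 2; rewrite -[v]subr0; apply: fi.
constructor 3; apply: fi => //.
by move: (fl _ Lu) (fl _ Lv) (fl _ L0) ne ne'; do 3 case: (f _) => [|[|?]].
Qed.

(** Twice [L] lies in the span of the frame. A linear form that is integral on the frame but not
    half-integral on [L] therefore refutes index at most 2. *)
Lemma frame_functional L F (t : 'cV[R]_n) v : is_lattice L -> has_maximal_index L 2 -> frame L F ->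
  (forall i, (F *m t) i 0 \is a Num.int) -> L v -> 2 * (v *m t) 0 0 \is a Num.int.
Proof.
move=> hL hmax fF Ft Lv; have [uF _] := fF.
have test w : int_span (rows F) w -> (w *m t) 0 0 \is a Num.int.
  move=> /int_span_rows -/(_ uF) wF; rewrite -(mulmxKV uF w) -[_ *m F *m t]mulmxA mxE.
  by apply: rpred_sum => i _; rewrite rpredM ?wF ?Ft.
have vt : (v *m t) 0 0 \is a Num.int -> 2 * (v *m t) 0 0 \is a Num.int.
  by move=> iv; rewrite mulr_natl rpredMn.
(* The vectors [v] and [- v] are compared because their difference is twice [v]. *)
have [/test/vt //|/test|/test] := frame_dichotomy hL hmax fF Lv (latticeN hL Lv).
  by rewrite mulNmx mxE rpredN => /vt.
by rewrite opprK mulmxDl mxE mulr_natl mulr2n.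
Qed.
End Frames.

(** * Minimal vectors as sign vectors in a fixed frame *)

Section SignVectors.
Variables (R : realType) (n : nat) (L : set 'rV[R]_n) (P : 'M[R]_n).
Hypotheses (hL : is_lattice L) (hmax : has_maximal_index L 2).
Hypothesis hlen : forall X, even_min_set L X -> (n <= size X)%N.
Hypothesis fP : frame L P.
Implicit Types (a b x : 'rV[R]_n) (A B C S : {set 'I_n}) (c d i : 'I_n).

Let uP : P \in unitmx := fP.1.

(** The rows in [U] form an even set, and the length forces such a set to have [n] elements. *)
Lemma frame_even_full F (U : {set 'I_n}) c : frame L F -> c \in U ->
  L (2^-1 *: \sum_(i in U) row i F) -> U = [set: 'I_n]%SET.
Proof.
move=> [uF mF] cU LU; apply/eqP; rewrite eqEcard finset.subsetT cardsT card_ord.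
suff : even_min_set L [seq row i F | i <- enum U] by move/hlen; rewrite size_map -cardE.
split.
- by rewrite -size_eq0 size_map -cardE -lt0n; apply/card_gt0P; exists c.
- have : free [seq row i F | i <- enum 'I_n] by rewrite (free_rows F).
  have /perm_map/perm_free -> : perm_eq (enum 'I_n) (enum U ++ enum (~: U)).
    apply: uniq_perm => [||i]; rewrite ?enum_uniq //.
      by rewrite cat_uniq !enum_uniq andbT; apply/hasPn => i; rewrite !mem_enum inE.
    by rewrite mem_cat !mem_enum !inE orbN.
  by rewrite map_cat => /catl_free.
- by move=> _ /mapP[i _ ->].
- rewrite /=; exists (2^-1 *: \sum_(i in U) row i F) => //.
  by rewrite big_map big_enum /= -scaler_nat scalerA mulfV ?pnatr_eq0 // scale1r.
Qed.

Definition repl S (f : 'I_n -> 'rV[R]_n) : 'M[R]_n :=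
  \matrix_(c, d) if c \in S then f c 0 d else (c == d)%:R.

Lemma row_repl S f c : row c (repl S f *m P) = if c \in S then f c *m P else row c P.
Proof.
rewrite row_mul; case: ifP => cS.
  by congr (_ *m _); apply/rowP => d; rewrite !mxE cS.
by rewrite [row c P]rowE; congr (_ *m _); apply/rowP => d; rewrite !mxE cS eqxx eq_sym.
Qed.

(** The identity rows kill all kernel coordinates outside [S], so invertibility is that of the block
    on [S]. *)
Lemma repl_frame S f : (forall c, c \in S -> min_vectors L (f c *m P)) ->
  (forall w : 'I_n -> R, (forall c, c \in S -> \sum_(d in S) f c 0 d * w d = 0) ->
     forall d, d \in S -> w d = 0) ->
  frame L (repl S f *m P).
Proof.
move=> mf ker; split=> [|c]; last by rewrite row_repl; case: ifP => // cS; [exact: mf|exact: fP.2].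
rewrite unitmx_mul uP andbT -unitmx_tr -row_free_unit; apply: inj_row_free => v v0.
have v0c c : \sum_d repl S f c d * v 0 d = 0.
  have vE := congr1 (fun w : 'rV_n => w 0 c) v0; rewrite mxE [RHS]mxE in vE; rewrite -[RHS]vE.
  by apply: eq_bigr => d _; rewrite [_^T _ _]mxE mulrC.
have vN c : c \notin S -> v 0 c = 0.
  move=> cS; rewrite -[RHS](v0c c) (bigD1 c) //= big1 ?addr0 => [|d dc].
    by rewrite mxE (negbTE cS) eqxx mul1r.
  by rewrite mxE (negbTE cS) eq_sym (negbTE dc) mul0r.
apply/rowP => d; rewrite mxE; have [dS|/vN //] := boolP (d \in S).
apply: ker dS => c cS; rewrite -[RHS](v0c c) [RHS](bigID (mem S)) /= [X in _ + X]big1 ?addr0.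
  by apply: eq_bigr => e eS; rewrite mxE cS.
by move=> e eS; rewrite vN ?mulr0.
Qed.

(** A form supported on [S] vanishes on the rows that were kept, so integrality has to be checked on
    the new rows only. *)
Lemma repl_functional S f (s : 'I_n -> R) a : frame L (repl S f *m P) ->
  (forall c, c \in S -> \sum_(d in S) f c 0 d * s d \is a Num.int) ->
  L (a *m P) -> 2 * \sum_(d in S) a 0 d * s d \is a Num.int.
Proof.
move=> fF sS La; pose t : 'cV[R]_n := \col_d if d \in S then s d else 0.
have tE (b : 'rV[R]_n) : (b *m t) 0 0 = \sum_(d in S) b 0 d * s d.
  rewrite mxE [RHS]big_mkcond; apply: eq_bigr => d _; rewrite mxE.
  by case: ifP => // _; rewrite mulr0.
rewrite -tE -{1}(mulmxK uP a) -[_ *m t]mulmxA.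
apply: (frame_functional hL hmax fF) => // c.
rewrite -[_ *m P *m _]mulmxA (mulmxA P) mulmxV // mul1mx.
have -> : (repl S f *m t) c 0 = (row c (repl S f) *m t) 0 0 by rewrite -row_mul [RHS]mxE.
rewrite tE; have [cS|cS] := boolP (c \in S).
  by rewrite (eq_bigr (fun d => f c 0 d * s d)) ?sS // => d _; rewrite !mxE cS.
rewrite big1 ?rpred0 // => d dS; rewrite !mxE (negbTE cS).
by rewrite (_ : c == d = false) ?mul0r //; apply: contraNF cS => /eqP->.
Qed.

Lemma int_comb_lattice a : (forall i, a 0 i \is a Num.int) -> L (a *m P).
Proof.
move=> ia; rewrite mulmx_sum_row; apply: lattice_sum => // i _.
by apply: latticeZ => //; have [] := fP.2 i.
Qed.

Lemma min_vectorsN x : min_vectors L x -> min_vectors L (- x).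
Proof.
move=> [Lx x0 xmin]; split; rewrite ?oppr_eq0 //; first exact: latticeN.
by move=> y Ly y0; rewrite /dot linearN mulNmx mulmxN opprK; apply: xmin.
Qed.

Definition sgn A : 'rV[R]_n := \row_c (2^-1 * (-1) ^+ (c \in A)).

Hypothesis n_gt0 : (0 < n)%N.
Hypothesis half_sum : L (const_mx 2^-1 *m P).

Lemma half_notint (k : int) : k%:~R != 2^-1 :> R.
Proof.
apply/eqP => k2; have : (k * 2)%:~R = 1%:~R :> R by rewrite intrM k2; field.
by move/intr_inj; lia.
Qed.

Lemma coord_int_or_half x : L x ->
  (forall i, (x *m invmx P) 0 i \is a Num.int) \/
  (forall i, (x *m invmx P) 0 i - 2^-1 \is a Num.int).
Proof.
move=> Lx; have [/(int_span_rows _ uP) xi|/(int_span_rows _ uP)|/(int_span_rows _ uP) xi] :=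
  frame_dichotomy hL hmax fP Lx half_sum.
- by left.
- move=> /(_ (Ordinal n_gt0)); rewrite mulmxK // mxE => /intrP[k /esym/eqP].
  by rewrite (negbTE (half_notint k)).
- by right=> i; have := xi i; rewrite mulmxBl mulmxK // !mxE.
Qed.

(** Let [x] replace row [i]. The [i]th coordinate divided by [a 0 i] is integral on the new frame,
    and twice its value at the half-sum is the inverse of [a 0 i]. *)
Lemma coord_inv x i (a := x *m invmx P) : min_vectors L x -> a 0 i != 0 ->
  (a 0 i)^-1 \is a Num.int.
Proof.
move=> mx ai; have aP : a *m P = x by rewrite mulmxKV.
have fr : frame L (repl [set i]%SET (fun=> a) *m P).
  apply: repl_frame => [c _|w w0 d /set1P->]; first by rewrite aP.
  have := w0 i; rewrite finset.set11 big_set1 => /(_ isT)/eqP.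
  by rewrite mulf_eq0 (negbTE ai) => /eqP.
have := @repl_functional _ _ (fun=> (a 0 i)^-1) _ fr _ half_sum.
rewrite !big_set1 [const_mx _ _ _]mxE mulrA !mulfV ?pnatr_eq0 // mul1r; apply=> c _.
exact: rpred1.
Qed.

(** Since nonzero coordinates have integral inverses, integral ones are 0 or a sign, and half-odd
    ones are half a sign. The length then excludes integral vectors with several nonzero
    coordinates. *)
Lemma min_vectors_sgn x : min_vectors L x ->
  (exists A, x = sgn A *m P) \/ (exists i, x = row i P \/ x = - row i P).
Proof.
move=> mx; pose a := x *m invmx P; have aP : a *m P = x by rewrite mulmxKV.
have [Lx x0 _] := mx.
have ainv i : a 0 i != 0 -> (a 0 i)^-1 \is a Num.int by exact: coord_inv.
have := coord_int_or_half Lx; rewrite -/a; move: a aP ainv => a aP ainv.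
case=> [ai|ah].
- right.
  have a1 i : a 0 i = 0 \/ a 0 i = 1 \/ a 0 i = -1.
    have [->|a0] := eqVneq (a 0 i) 0; [by left|right].
    have /intrP[m mE] := ainv _ a0; have /intrP[k kE] := ai i.
    have : (k * m)%:~R = 1%:~R :> R by rewrite intrM -kE -mE divff.
    move/intr_inj => km; have : (`|k| <= 1)%N.
      by apply: dvdn_leq => //; apply/dvdnP; exists `|m|%N; rewrite mulnC -abszM km.
    have k0 : k != 0 by apply: contra_eq_neq km => ->; rewrite mul0r.
    move=> k1; have [|] : k = 1 \/ k = -1 by lia.
      by move=> k1'; left; rewrite kE k1'.
    by move=> k1'; right; rewrite kE k1'.
  have [i ai0] : exists i, a 0 i != 0.
    apply/existsP; apply: contraNT x0; rewrite negb_exists => /forallP a0.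
    rewrite -aP (_ : a = 0) ?mul0mx ?eqxx //; apply/rowP => i; rewrite [RHS]mxE.
    by apply/eqP; have := a0 i; rewrite negbK.
  have fr : frame L (repl [set i]%SET (fun=> a) *m P).
    apply: repl_frame => [c _|w w0 d /set1P->]; first by rewrite aP.
    have := w0 i; rewrite finset.set11 big_set1 => /(_ isT)/eqP.
    by rewrite mulf_eq0 (negbTE ai0) => /eqP.
  (* Adding to [x] the rows where it vanishes makes every coordinate odd, so half of this sum lies
     in [L]. *)
  have UT : (i |: [set c | a 0 c == 0] = [set: 'I_n])%SET.
    apply: (frame_even_full (c := i) fr); first by rewrite !inE eqxx.
    rewrite big_setU1 /= ?inE ?ai0 // row_repl finset.set11.
    rewrite (eq_bigr (fun c => row c P)); last first.
      by move=> c; rewrite row_repl !inE => /eqP ac; case: eqP => // ci; rewrite -ci ac eqxx in ai0.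
    have -> : 2^-1 *: (a *m P + \sum_(c in [set c | a 0 c == 0]%SET) row c P) =
       (\row_c (2^-1 * (a 0 c - 1 + (a 0 c == 0)%:R))) *m P + const_mx 2^-1 *m P.
      rewrite -mulmxDl.
      have -> : \sum_(c in [set c | a 0 c == 0]%SET) row c P = (\row_c (a 0 c == 0)%:R) *m P.
        rewrite mulmx_sum_row big_mkcond; apply: eq_bigr => c _; rewrite inE mxE.
        by case: ifP => _; rewrite ?scale1r ?scale0r.
      rewrite -mulmxDl scalemxAl; congr (_ *m _); apply/rowP => c; rewrite !mxE; ring.
    apply: latticeD => //; apply: int_comb_lattice => c; rewrite mxE.
    case: (a1 c) => [->|[]->]; rewrite ?eqxx ?oner_eq0 ?oppr_eq0 ?oner_eq0.
    - by rewrite sub0r addrC subrr mulr0 rpred0.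
    - by rewrite subrr addr0 mulr0 rpred0.
    - rewrite addr0 (_ : _ * _ = -1) ?rpredN1 //; by field.
  have xE : x = a 0 i *: row i P.
    rewrite -aP mulmx_sum_row (bigD1 i) //= big1 ?addr0 // => c ci.
    have : c \in [set: 'I_n]%SET by rewrite inE.
    by rewrite -UT !inE (negbTE ci) /= => /eqP->; rewrite scale0r.
  exists i; case: (a1 i) => [a0|[] a0]; first by rewrite a0 eqxx in ai0.
    by left; rewrite xE a0 scale1r.
  by right; rewrite xE a0 scaleN1r.
- left; exists [set i | a 0 i < 0]%SET; rewrite -{1}aP; congr (_ *m _); apply/rowP => i.
  have [k kE] : exists k : int, a 0 i - 2^-1 = k%:~R by exact/intrP.
  have a0 : a 0 i != 0.
    apply/eqP => a0; have /negP := half_notint (- k); apply.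
    by rewrite intrN -kE a0 sub0r opprK.
  have /intrP[m mE] := ainv _ a0.
  have : ((2 * k + 1) * m)%:~R = 2%:~R :> R.
    by rewrite intrM intrD intrM -kE -mE; field.
  move/intr_inj => km.
  (* An odd divisor of 2 is a sign. *)
  have : (2 * k + 1 = 1 \/ 2 * k + 1 = - 1)%R.
    have : (`|(2 * k + 1)%R|%N <= 2)%N.
      by apply: dvdn_leq => //; apply/dvdnP; exists `|m|%N; rewrite mulnC -abszM km.
    lia.
  have aE : a 0 i = k%:~R + 2^-1 by rewrite -kE subrK.
  rewrite !mxE inE; case=> kk.
    have k0 : k = 0 by lia.
    rewrite aE k0 add0r ltNge invr_ge0 ler0n /=; lra.
  have k0 : k = -1 by lia.
  rewrite aE k0; have -> : ((-1)%:~R + 2^-1 < 0 :> R) by lra.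
  by rewrite expr1; field.
Qed.

Lemma sgn_setC A : sgn (~: A) = - sgn A.
Proof. by apply/rowP => c; rewrite !mxE inE; case: (c \in A); rewrite /= ?expr0 ?expr1; ring. Qed.

Lemma big_set4 (V : nmodType) (k l m j : 'I_n) (g : 'I_n -> V) : uniq [:: k; l; m; j] ->
  \sum_(d in [set d in [:: k; l; m; j]]%SET) g d = g k + (g l + (g m + g j)).
Proof.
move=> unq; rewrite (eq_bigl (mem [:: k; l; m; j])) => [|d]; last by rewrite inE.
by rewrite -big_uniq //= !big_cons big_nil addr0.
Qed.

(** The four vectors replace rows [k], [l], [m], [j], the Hadamard block being invertible. Their
    sum, corrected by some old rows, is twice a lattice vector; row [i] does not occur in this
    relation, against the length. *)
Lemma no_hadamard_sgn (A : bool -> bool -> {set 'I_n}) B (k l m i j : 'I_n) :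
  uniq [:: k; l; m; i; j] -> (forall a b : bool, min_vectors L (sgn (A a b) *m P)) ->
  (forall a b : bool, [/\ (k \in A a b) = (k \in B) (+) a,
                   (l \in A a b) = (l \in B) (+) b,
                   (m \in A a b) = (m \in B) (+) (a (+) b),
                   (i \in A a b) = (i \in B) & (j \in A a b) = (j \in B)]) ->
  False.
Proof.
move=> unq mA HA.
have [unq4 iS] : uniq [:: k; l; m; j] /\ i \notin [:: k; l; m; j].
  move: unq; rewrite /= !inE !negb_or -!andbA.
  case/and5P=> kl km ki kj /and5P[lm li lj mi /and3P[mj ij _]].
  by rewrite kl km kj lm lj mj [i == k]eq_sym [i == l]eq_sym [i == m]eq_sym ki li mi ij.
pose S := [set d in [:: k; l; m; j]]%SET.
have [kS lS mS jS] : [/\ k \in S, l \in S, m \in S & j \in S] by rewrite !inE !eqxx ?orbT.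
pose f d := sgn (if d == k then A false false else if d == l then A false true
                 else if d == m then A true false else A true true).
have [fk fl fm fj] : [/\ f k = sgn (A false false), f l = sgn (A false true),
    f m = sgn (A true false) & f j = sgn (A true true)].
  move: unq4; rewrite /= !inE !negb_or -!andbA => /and5P[kl km kj lm /and3P[lj mj _]].
  have sy (x y : 'I_n) : x != y -> (y == x) = false by rewrite eq_sym => /negbTE.
  by split; rewrite /f ?eqxx ?(sy _ _ kl, sy _ _ km, sy _ _ kj, sy _ _ lm, sy _ _ lj, sy _ _ mj).
have fr : frame L (repl S f *m P).
  apply: repl_frame => [c _|w w0].
    rewrite /f; case: (c == k) => /=; last case: (c == l) => /=; last case: (c == m) => /=;
      exact: mA.
  (* [h] absorbs the column signs and leaves the plain Hadamard system. *)
  pose h c := (-1) ^+ (c \in B) * w c.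
  have sE (a b : bool) : \sum_(d in S) sgn (A a b) 0 d * w d =
      2^-1 * ((-1) ^+ a * h k + ((-1) ^+ b * h l + ((-1) ^+ a * (-1) ^+ b * h m + h j))).
    rewrite big_set4 // !mxE; have [-> -> -> _ ->] := HA a b.
    by rewrite !signr_addb /h; ring.
  have := w0 k kS; rewrite fk sE => e1; have := w0 l lS; rewrite fl sE => e2.
  have := w0 m mS; rewrite fm sE => e3; have := w0 j jS; rewrite fj sE => e4.
  rewrite /= ?expr0 ?expr1 in e1 e2 e3 e4.
  have hw c : h c = 0 -> w c = 0 by move/eqP; rewrite mulf_eq0 signr_eq0 => /eqP.
  move=> d; rewrite inE !inE => /or4P[] /eqP->; apply: hw; lra.
(* In these columns an odd number of the four signs is negative: the four entries sum to 1 or -1,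
   and adding row [c] makes the coordinate even. *)
pose X := [set c | (c \in A false false) (+) (c \in A false true) (+)
                   (c \in A true false) (+) (c \in A true true)]%SET.
have XN d : d \in [:: k; l; m; i; j] -> d \notin X.
  have [k1 l1 m1 i1 j1] := HA false false; have [k2 l2 m2 i2 j2] := HA false true.
  have [k3 l3 m3 i3 j3] := HA true false; have [k4 l4 m4 i4 j4] := HA true true.
  rewrite !inE => /or4P[|||/orP[]] /eqP->.
  - by rewrite k1 k2 k3 k4; case: (_ \in B).
  - by rewrite l1 l2 l3 l4; case: (_ \in B).
  - by rewrite m1 m2 m3 m4; case: (_ \in B).
  - by rewrite i1 i2 i3 i4; case: (_ \in B).
  - by rewrite j1 j2 j3 j4; case: (_ \in B).
have UT : (S :|: X = [set: 'I_n])%SET.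
  apply: (frame_even_full (c := k) fr); first by rewrite finset.in_setU kS.
  pose b : 'rV[R]_n := sgn (A false false) + (sgn (A false true)
    + (sgn (A true false) + sgn (A true true))) + \row_c (c \in X)%:R.
  have -> : \sum_(c in (S :|: X)%SET) row c (repl S f *m P) = b *m P.
    rewrite (bigID (mem S)) /= (eq_bigl (fun c => c \in S)); last first.
      by move=> c /=; rewrite finset.in_setU; case: (c \in S); rewrite ?andbF.
    rewrite [X in _ + X](eq_bigl (fun c => c \in X)); last first.
      move=> c /=; rewrite finset.in_setU; have [cS|_] := boolP (c \in S);
        rewrite ?andbF ?andbT //=.
      apply/esym/negbTE/XN; move: cS; rewrite !inE.
      by case/or4P => ->; rewrite ?orbT.
    rewrite (eq_bigr (fun c => f c *m P)); last by move=> c cS; rewrite row_repl cS.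
    rewrite big_set4 // fk fl fm fj [X in _ + X](eq_bigr (fun c => row c P)); last first.
      move=> c cX; rewrite row_repl; case: ifP => // cS; have /negP[] // : c \notin X.
      by apply: XN; move: cS; rewrite !inE => /or4P[] ->; rewrite ?orbT.
    have -> : \sum_(c in X) row c P = (\row_c (c \in X)%:R) *m P.
      rewrite mulmx_sum_row big_mkcond; apply: eq_bigr => c _; rewrite mxE.
      by case: ifP => _; rewrite ?scale1r ?scale0r.
    by rewrite -!mulmxDl.
  have int3 (y : R) : y = 0 \/ y = 1 \/ y = -1 -> y \is a Num.int.
    by case=> [->|[]->]; rewrite ?rpredN ?rpred0 ?rpred1.
  rewrite scalemxAl; apply: int_comb_lattice => c; apply: int3; rewrite !mxE inE.
  case: (c \in A _ _); case: (c \in A _ _); case: (c \in A _ _); case: (c \in A _ _);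
    rewrite /= ?expr0 ?expr1;
    first [by left; field | by right; left; field | by right; right; field].
have : i \in (S :|: X)%SET by rewrite UT inE.
rewrite inE (negbTE (XN i _)) ?orbF; last by rewrite !inE eqxx ?orbT.
by rewrite finset.inE (negbTE iS).
Qed.

(** The five vectors replace the rows in [C]. A form equal to 1 on each of them takes the value 2/3,
    up to sign, on an old row, whose double is not an integer. *)
Lemma no_simplex_sgn (A : 'I_n -> {set 'I_n}) B C : #|C| = 5 ->
  (forall c, c \in C -> min_vectors L (sgn (A c) *m P)) ->
  (forall c d, c \in C -> d \in C -> (d \in A c) = (d \in B) (+) (d == c)) -> False.
Proof.
move=> C5 mA HA.
have sE (w : 'I_n -> R) c : c \in C -> \sum_(d in C) sgn (A c) 0 d * w d =
    2^-1 * (\sum_(d in C) (-1) ^+ (d \in B) * w d - 2 * ((-1) ^+ (c \in B) * w c)).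
  move=> cC; rewrite (bigD1 c) //= [in RHS](bigD1 c) //= mxE HA // eqxx signr_addb.
  rewrite (eq_bigr (fun d => 2^-1 * ((-1) ^+ (d \in B) * w d))) => [|d /andP[dC dc]].
    by rewrite -big_distrr /= expr1; ring.
  by rewrite mxE HA // (negbTE dc) addbF mulrA.
have fr : frame L (repl C (fun c => sgn (A c)) *m P).
  apply: repl_frame => // w w0 d dC.
  pose T := \sum_(d in C) (-1) ^+ (d \in B) * w d.
  (* Summing these five equalities gives [T] equal to 5/2 times itself, hence zero. *)
  have hE c : c \in C -> (-1) ^+ (c \in B) * w c = T / 2.
    by move=> cC; have := w0 c cC; rewrite sE // -/T; lra.
  have T0 : T = 0.
    have : T = \sum_(c in C) T / 2 by apply: eq_bigr => c /hE.
    rewrite sumr_const C5 -mulr_natr; lra.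
  have /eqP := hE d dC; rewrite T0 mul0r mulf_eq0 signr_eq0 => /eqP //.
have /card_gt0P[c cC] : (0 < #|C|)%N by rewrite C5.
have L1 : L (delta_mx 0 c *m P) by rewrite -rowE; have [] := fP.2 c.
(* The functional with coordinates [2 / 3 * (-1) ^+ (d \in B)] takes the value 1
   on each of the five sign vectors. *)
have : 2 * \sum_(d in C) (delta_mx 0 c : 'rV[R]_n) 0 d
    * ((-1) ^+ (d \in B) * (2 / 3)) \is a Num.int.
  apply: repl_functional fr _ L1 => e eC; rewrite sE //.
  rewrite (eq_bigr (fun=> 2 / 3)) => [|d _]; last by rewrite signrMK.
  by rewrite sumr_const C5 signrMK -mulr_natr (_ : _ * _ = 1) ?rpred1 //; field.
rewrite (bigD1 c) //= big1 => [|d /andP[_ dc]]; last by rewrite mxE eqxx (negbTE dc) mul0r.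
rewrite mxE !eqxx mul1r addr0 => /intrP[z zE].
have : (z * 3)%:~R = ((-1) ^+ (c \in B) * 4)%:~R :> R.
  by rewrite intrM -zE intrM rmorphXn /= rmorphN1; field.
by move/intr_inj; case: (c \in B); rewrite ?expr0 ?expr1; lia.
Qed.

Definition sgn_family : {set {set 'I_n}} :=
  [set A : {set 'I_n} | `[< min_vectors L (sgn A *m P) >]]%SET.

Lemma good_sgn_family : good [set: 'I_n]%SET sgn_family.
Proof.
have inF A : A \in sgn_family -> min_vectors L (sgn A *m P) by rewrite inE => /asboolP.
split.
- by move=> A _; exact: finset.subsetT.
- move=> A /inF mA; rewrite finset.setTD inE; apply/asboolP.
  by rewrite sgn_setC mulNmx; apply: min_vectorsN.
- by move=> A B k l m i j unq _ AF; apply: no_hadamard_sgn unq _ => a b; apply: inF.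
- by move=> A B C _ C5 AF; apply: no_simplex_sgn C5 _ => c /AF/inF.
Qed.

Lemma min_vectors_half_list : (5 < n)%N -> exists s : seq 'rV[R]_n,
  (2 * size s < n * (n + 1))%N /\ forall x, min_vectors L x -> x \in s \/ - x \in s.
Proof.
move=> n5; pose i0 := Ordinal n_gt0.
(* Fixing the sign at [i0] selects one vector of each opposite pair. *)
pose H := [set A in sgn_family | i0 \in A]%SET.
have gF := good_sgn_family.
have cH : (#|sgn_family| = 2 * #|H|)%N.
  rewrite -(cardsID [set A : {set 'I_n} | i0 \in A]%SET sgn_family) mul2n -addnn.
  congr (_ + _)%N; first by apply: eq_card => A; rewrite !inE.
  have inj : injective (fun A : {set 'I_n} => ~: A)%SET.
    by move=> A B /(congr1 (fun A => ~: A)%SET); rewrite !finset.setCK.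
  rewrite -(card_imset (mem H) inj); apply: eq_card => A.
  rewrite -[A in RHS]finset.setCK mem_imset //.
  have := @good_compl _ _ _ gF; rewrite !finset.inE => gC.
  apply/andP/andP => [[iA AF]|[AF iA]].
    by have := gC A; rewrite finset.setTD !finset.inE => ->.
  split=> //; have := gC (~: A)%SET; rewrite finset.setTD finset.setCK !finset.inE; exact.
have [|_] := card_good gF; rewrite cardsT card_ord; first exact: ltnW.
move=> /(_ n5) bound.
exists ([seq row i P | i <- enum 'I_n] ++ [seq sgn A *m P | A <- enum H]); split.
  rewrite size_cat !size_map -enumT size_enum_ord -cardE.
  (* Twice the list has length [2 * n + #|sgn_family|], below [2 * n + n * n.-1]. *)
  move: bound n5; rewrite cH; move: (#|H|) => q; move: (n) => [//|p]; rewrite succnK; nia.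
move=> x mx; have [[A xA]|[i xi]] := min_vectors_sgn mx.
  have [iA|iA] := boolP (i0 \in A).
    left; rewrite mem_cat; apply/orP; right; rewrite xA; apply: map_f.
    by rewrite mem_enum !inE iA andbT; apply/asboolP; rewrite -xA.
  right; rewrite mem_cat; apply/orP; right; rewrite xA -mulNmx -sgn_setC; apply: map_f.
  rewrite mem_enum !inE iA andbT; apply/asboolP.
  by rewrite sgn_setC mulNmx -xA; apply: min_vectorsN.
have rowP' : row i P \in [seq row i P | i <- enum 'I_n] by apply: map_f; rewrite mem_enum.
by case: xi => ->; [left|right]; rewrite ?opprK mem_cat rowP'.
Qed.

End SignVectors.

(** * Counting pairs of minimal vectors, and perfection *)

Section Conclusion.
Variables (R : realType) (n : nat) (L : set 'rV[R]_n).

(** An even set of [n] independent minimal vectors is itself a frame. *)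
Lemma length_frame : has_length L n ->
  exists P, frame L P /\ L (const_mx 2^-1 *m P).
Proof.
move=> [[X [[_ fX mX [v Lv vX]] szX]] _].
have [P XP] := tuple_rows (tcast szX (in_tuple X)).
have {}XP : X = rows P by rewrite -XP val_tcast.
exists P; split; first split=> [|i].
- by rewrite -free_rows -XP.
- by apply: mX; rewrite XP; apply: map_f; rewrite mem_enum.
suff -> : const_mx 2^-1 *m P = v by [].
have : v *+ 2 = \sum_(i < n) row i P by rewrite vX XP big_map big_enum.
rewrite mulmx_sum_row => vE; under eq_bigr do rewrite mxE.
by rewrite -scaler_sumr -vE -scaler_nat scalerA mulVf ?pnatr_eq0 // scale1r.
Qed.

Variable s : seq 'rV[R]_n.
Hypothesis sL : forall x, min_vectors L x -> x \in s \/ - x \in s.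

Lemma card_min_pairs : exists k, min_pairs L #= `I_k /\ (k <= size s)%N.
Proof.
have le : min_pairs L #<= `I_(size s).
  apply: card_le_trans (card_image_le (fun q => [set nth 0 s q; - nth 0 s q]) `I_(size s)).
  apply: subset_card_le => _ [x mx <-].
  have [xs|xs] := sL mx.
    by exists (index x s); rewrite /= ?index_mem // nth_index.
  by exists (index (- x) s); rewrite /= ?index_mem // nth_index // opprK setUC.
have /finite_setP[k hk] : finite_set (min_pairs L) by apply/finite_set_leP; exists (size s).
by exists k; split=> //; rewrite -card_le_II -(card_le_eql hk).
Qed.

Lemma line_projN (x : 'rV[R]_n) : line_proj (- x) = line_proj x.
Proof. by rewrite /line_proj /dot linearN /= mulmxN mulNmx mulmxN mulNmx !opprK. Qed.

(* Every matrix is the sum of a symmetric and a strictly upper triangular one. *)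
Lemma perfect_card : perfect L -> (n * (n + 1) <= 2 * size s)%N.
Proof.
move=> pL; pose pairs := [set p : 'I_n * 'I_n | (p.1 < p.2)%N]%SET.
pose up := [seq delta_mx p.1 p.2 : 'M[R]_n | p <- enum pairs].
pose V := <<[seq line_proj x | x <- s]>>%VS.
have symV A : A^T = A -> A \in V.
  move=> symA; have [r [rL Ar]] : lin_span [set line_proj x | x in min_vectors L] A by rewrite pL.
  apply: subvP Ar; apply/span_subvP => _ /rL[x mx <-]; apply: memv_span.
  have [xs|xs] := sL mx; first exact: map_f.
  by rewrite -line_projN map_f.
have full : (fullv <= V + <<up>>)%VS.
  (* Subtracting [U] overwrites the upper triangle of [A] by the mirror image of the lower one. *)
  apply/subvP => A _; pose U := \matrix_(i, j) (if (i < j)%N then A i j - A j i else 0).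
  rewrite -[A](subrK U); apply: memv_add.
    apply: symV; apply/matrixP => i j; rewrite !mxE.
    by case: ltngtP => [ij|ij|/val_inj->]; rewrite ?subr0 // subKr.
  rewrite (matrix_sum_delta U); apply: memv_suml => i _; apply: memv_suml => j _.
  rewrite mxE; case: ifP => ij; last by rewrite scale0r mem0v.
  by apply/memvZ/memv_span/mapP; exists (i, j); rewrite // mem_enum inE.
have dimV : (\dim V <= size s)%N by rewrite (leq_trans (dim_span _)) ?size_map.
have dim_up : (\dim <<up>> <= #|pairs|)%N by rewrite (leq_trans (dim_span _)) // size_map -cardE.
have nn : (n * n <= #|pairs| + size s)%N.
  have := dimvS full; rewrite dimvf dim_matrix => le; apply: leq_trans le _.
  by rewrite (leq_trans (dimv_add_leqif _ _)) // addnC leq_add.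
have pairsE : #|pairs| = (\sum_(i < n) \sum_(j < n) (i < j))%N.
  rewrite -sum1_card big_mkcond pair_big /=; apply: eq_bigr => p _.
  by rewrite inE; case: ltnP.
have diag : n = (\sum_(i < n) \sum_(j < n) (i == j))%N.
  rewrite -[LHS]card_ord -sum1_card; apply: eq_bigr => i _.
  by rewrite (bigD1 i) //= eqxx big1 // => j; rewrite eq_sym => /negbTE->.
(* Index pairs lie above, below or on the diagonal; combined with [nn] this bounds [size s] below by
   the dimension of the symmetric matrices. *)
have : (n * n = #|pairs| + #|pairs| + n)%N.
  rewrite {2}pairsE exchange_big /= pairsE [X in (_ = _ + X)%N]diag -!big_split /=.
  rewrite -[n in LHS]card_ord -sum_nat_const; apply: eq_bigr => i _.
  rewrite -!big_split /=; transitivity (\sum_(j < n) 1)%N; first by rewrite sum1_card card_ord.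
  by apply: eq_bigr => j _; rewrite -val_eqE /=; case: ltngtP.
by move: nn; lia.
Qed.

End Conclusion.

Theorem theorem1p1 (R : realType) (n : nat) (hn : (6 <= n)%N)
    (L : set 'rV[R]_n) (hL : is_lattice L) (hwr : well_rounded L)
    (hindex : has_maximal_index L 2) (hlength : has_length L n) :
  (exists k : nat, min_pairs L #= `I_k /\ (k < (n * (n + 1)) %/ 2)%N) /\
  ~ perfect L.
Proof.
have n_gt0 : (0 < n)%N by exact: leq_trans hn.
have [P [fP half]] := length_frame hlength.
have [s [ss sL]] := min_vectors_half_list hL hindex hlength.2 fP n_gt0 half hn.
split=> [|/(perfect_card sL)]; last by rewrite leqNgt ss.
have [k [hk ks]] := card_min_pairs sL.
(* The halving is exact, since [n * (n + 1)] is even. *)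
exists k; split=> //; rewrite ltn_divRL; last by rewrite dvdn2 oddM oddD; case: (odd n).
by rewrite mulnC (leq_ltn_trans _ ss) // leq_mul2l.
Qed.
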